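(* Let $d\ge 1$, let $W=\mathbb{R}^d$, and let $S\subseteq W$ be a closed convex polyhedron. Let $\phi:\mathbb{C}[x]\to M(S)$ be the surjective $\mathbb{C}$-algebra homomorphism determined by $\phi(x)=[S]$, and let $I=\ker(\phi)$. Then: (a) if $S=\emptyset$, then $I=(x)$; (b) if $S=\{0\}$, then $I=(x-1)$; (c) if $S\notin\{\emptyset,\{0\}\}$ and $S=2S$ (in particular for $S=W$), then $I=(x(x-1))$; (d) if $S\notin\{\emptyset,\{0\}\}$ and $S\neq 2S$ (in particular for a bounded convex polytope $S\notin\{\emptyset,\{0\}\}$), then $I=(0)$.
   Context: For $S\subseteq W=\mathbb{R}^d$, $[S]:W\to\mathbb{C}$ denotes its indicator function (so $[\emptyset]=0$). The Minkowski sum is $A+B=\{a+b:a\in A,b\in B\}$. Let $M(\mathcal{P}(W))$ be the complex vector space of functions on $W$ spanned by the indicator functions of closed convex polyhedra; it is a commutative $\mathbb{C}$-algebra with the well-defined bilinear product determined by $[A]\cdot[B]=[A+B]$ for nonempty closed convex polyhedra $A,B$, with unit $[\{0\}]$. For a closed convex polyhedron $S$, $M(S)$ is the unital $\mathbb{C}$-subalgebra of $M(\mathcal{P}(W))$ generated by $[S]$. Here $2S=\{2s:s\in S\}$. *)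

(* Defs.v *)
From HB Require Import structures.
From mathcomp Require Import all_boot all_order all_algebra.
From mathcomp Require Import all_classical all_reals all_analysis.
From mathcomp Require Import complex ring lra.

Set Implicit Arguments.
Unset Strict Implicit.
Unset Printing Implicit Defensive.

Import Order.TTheory GRing.Theory Num.Theory numFieldNormedType.Exports.
Local Open Scope classical_set_scope.
Local Open Scope ring_scope.

Section Polyhedra.
Variable R : realType.

(* Degenerate half-spaces (zero normal vector) are allowed, so that both the
   empty set and the whole space are polyhedra. *)
Definition polyhedron n (A : set 'rV[R]_n) : Prop :=
  exists s : seq ('cV[R]_n * R),
    A = [set x | forall h, h \in s -> (x *m h.1) 0 0 <= h.2].

Definition mink_add n (A B : set 'rV[R]_n) : set 'rV[R]_n :=
  [set a + b | a in A & b in B].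

Definition dilate n (c : R) (A : set 'rV[R]_n) : set 'rV[R]_n :=
  [set c *: a | a in A].

Lemma polyhedronT n : @polyhedron n setT.
Proof. by exists [::]; apply/seteqP; split. Qed.

Lemma polyhedron0 n : @polyhedron n set0.
Proof.
exists [:: (0, -1)]; apply/seteqP; split=> // x /= /(_ (0, -1)).
by rewrite mem_head mulmx0 mxE oppr_ge0 ler10 => /(_ isT).
Qed.

Lemma polyhedronI n (A B : set 'rV[R]_n) :
  polyhedron A -> polyhedron B -> polyhedron (A `&` B).
Proof.
move=> [s ->] [t ->]; exists (s ++ t); apply/seteqP; split=> x /=.
  by move=> [xs xt] h; rewrite mem_cat => /orP[/xs|/xt].
by move=> xst; split=> h hs; apply: xst; rewrite mem_cat hs ?orbT.
Qed.

Lemma polyhedron_preim m n (L : 'M[R]_(m, n)) (c : 'rV[R]_n) A :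
  polyhedron A -> polyhedron [set x : 'rV[R]_m | A (x *m L + c)].
Proof.
move=> [s ->]; exists [seq (L *m h.1, h.2 - (c *m h.1) 0 0) | h <- s].
apply/seteqP; split=> x /= xs h.
  by case/mapP=> k ks -> /=; rewrite mulmxA lerBrDr; have := xs k ks;
    rewrite mulmxDl mxE.
move=> hs.
have := xs _ (map_f (fun h => (L *m h.1, h.2 - (c *m h.1) 0 0)) hs).
by rewrite /= mulmxA lerBrDr mulmxDl [X in _ -> X <= _]mxE.
Qed.

Lemma polyhedron_origin n : polyhedron [set (0 : 'rV[R]_n)].
Proof.
exists [seq (b *: delta_mx i 0, 0) | b <- [:: 1; -1 : R], i <- enum 'I_n].
apply/seteqP; split=> [x -> h /allpairsP[[b i] /= [_ _ ->]]|x xs /=].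
  by rewrite mul0mx mxE.
have xE b (i : 'I_n) : (x *m (b *: delta_mx i 0 : 'cV_n)) 0 0 = b * x 0 i.
  by rewrite -scalemxAr -colE !mxE.
have xle b i : b \in [:: 1; -1] -> b * x 0 i <= 0.
  move=> bin; rewrite -xE; apply: (xs (b *: delta_mx i 0, 0)).
  by apply/allpairsP; exists (b, i); rewrite mem_enum.
apply/rowP => i; rewrite mxE; apply/eqP.
rewrite eq_le -[leLHS]mul1r xle ?mem_head //=.
by rewrite -oppr_le0 -mulN1r xle // inE mem_head orbT.
Qed.


Lemma between (L U : seq R) :
  (forall l u, l \in L -> u \in U -> l <= u) ->
  exists t, (forall l, l \in L -> l <= t) /\ (forall u, u \in U -> t <= u).
Proof.
elim: L => [_|l L IH LU].
  elim: U => [|u U [t [_ tU]]]; first by exists 0.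
  exists (Num.min u t); split=> // w.
  by rewrite inE ge_min => /predU1P[->|/tU ->]; rewrite ?lexx ?orbT.
have [|t [Lt tU]] := IH.
  by move=> a u aL uU; apply: LU; rewrite // inE aL orbT.
exists (Num.max l t); split=> [a|u uU].
  by rewrite inE le_max => /predU1P[->|/Lt ->]; rewrite ?lexx ?orbT.
by rewrite ge_max tU // LU // mem_head.
Qed.

Definition shear n (v : 'rV[R]_n) (A : set 'rV[R]_n) : set 'rV[R]_n :=
  [set y | exists t : R, A (y + t *: v)].

(* One step of Fourier-Motzkin elimination. *)
Lemma polyhedron_shear n (v : 'rV[R]_n) A :
  polyhedron A -> polyhedron (shear v A).
Proof.
move=> [s ->]; pose c (h : 'cV[R]_n * R) := (v *m h.1) 0 0.
pose comb (p q : 'cV[R]_n * R) :=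
  (c p *: q.1 - c q *: p.1, c p * q.2 - c q * p.2).
exists ([seq h <- s | c h == 0] ++
  [seq comb p q | p <- [seq h <- s | 0 < c h], q <- [seq h <- s | c h < 0]]).
have lineE (y : 'rV_n) t h : ((y + t *: v) *m h.1) 0 0 = (y *m h.1) 0 0 + t * c h.
  by rewrite mulmxDl -scalemxAl mxE [X in _ + X]mxE.
have combE (y : 'rV_n) p q :
    (y *m (comb p q).1) 0 0 = c p * (y *m q.1) 0 0 - c q * (y *m p.1) 0 0.
  by rewrite mulmxBr -!scalemxAr mxE [X in X + _]mxE ![X in _ + X]mxE [X in _ - X]mxE.
apply/seteqP; split=> y /=.
  move=> [t yt] h; rewrite mem_cat => /orP[|/allpairsP[[p q] /= []]].
    rewrite mem_filter => /andP[/eqP ch hs].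
    by have := yt _ hs; rewrite lineE ch mulr0 addr0.
  rewrite !mem_filter => /andP[cp ps] /andP[cq qs] ->; rewrite combE /=.
  have := yt _ ps; have := yt _ qs; rewrite !lineE => hq hp.
  rewrite -subr_ge0 in hq; rewrite -subr_ge0 in hp; rewrite -subr_ge0.
  have cq' : 0 <= - c q by rewrite oppr_ge0 ltW.
  have := addr_ge0 (mulr_ge0 (ltW cp) hq) (mulr_ge0 cq' hp); lra.
move=> ys.
have [|t [Lt tU]] := @between
    [seq (h.2 - (y *m h.1) 0 0) / c h | h <- s & c h < 0]
    [seq (h.2 - (y *m h.1) 0 0) / c h | h <- s & 0 < c h].
  move=> _ _ /mapP[q + ->] /mapP[p + ->]; rewrite !mem_filter.
  move=> /andP[cq qs] /andP[cp ps].
  have := ys (comb p q); rewrite combE mem_cat => /= H.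
  rewrite ler_ndivrMr // mulrAC ler_pdivrMr //.
  have {}H : c p * (y *m q.1) 0 0 - c q * (y *m p.1) 0 0 <= c p * q.2 - c q * p.2.
    apply: H; apply/orP; right; apply/allpairsP; exists (p, q) => /=.
    by rewrite !mem_filter cp cq ps qs.
  lra.
exists t => h hs; rewrite lineE.
have [ch|ch|ch] := ltgtP (c h) 0.
- have : (h.2 - (y *m h.1) 0 0) / c h <= t.
    by apply: Lt; apply/mapP; exists h => //; rewrite mem_filter ch.
  by rewrite ler_ndivrMr // lerBrDl.
- have : t <= (h.2 - (y *m h.1) 0 0) / c h.
    by apply: tU; apply/mapP; exists h => //; rewrite mem_filter ch.
  by rewrite ler_pdivlMr // lerBrDl.
- by rewrite ch mulr0 addr0 ys // mem_cat mem_filter ch eqxx hs.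
Qed.

Definition shears k n (B : 'M[R]_(k, n)) (A : set 'rV[R]_n) : set 'rV[R]_n :=
  [set y | exists t : 'rV[R]_k, A (y + t *m B)].

Lemma shears0 n (B : 'M[R]_(0, n)) A : shears B A = A.
Proof.
apply/seteqP; split=> y /=; first by move=> [t]; rewrite (flatmx0 B) mulmx0 addr0.
by exists 0; rewrite mul0mx addr0.
Qed.

Lemma shearsS k n (B : 'M[R]_(1 + k, n)) A :
  shears B A = shear (usubmx B) (shears (dsubmx B) A).
Proof.
rewrite -{1}[B]vsubmxK; apply/seteqP; split=> y /=.
  move=> [t]; rewrite -[t]hsubmxK mul_row_col addrA => yA.
  exists (lsubmx t 0 0), (rsubmx t).
  by rewrite -mul_scalar_mx -mx11_scalar.
move=> [a [t yA]]; exists (row_mx a%:M t).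
by rewrite mul_row_col addrA mul_scalar_mx.
Qed.

Lemma polyhedron_shears k n (B : 'M[R]_(k, n)) A :
  polyhedron A -> polyhedron (shears B A).
Proof.
elim: k B => [|k IH] B pA; first by rewrite shears0.
by rewrite (@shearsS k n B); apply/polyhedron_shear/IH.
Qed.

Lemma polyhedron_mink_add n (A B : set 'rV[R]_n) :
  polyhedron A -> polyhedron B -> polyhedron (mink_add A B).
Proof.
move=> pA pB.
have pQ : polyhedron [set w : 'rV[R]_(n + n) | A (w *m col_mx 0 1%:M + 0) /\
                                        B (w *m col_mx 1%:M (- 1%:M) + 0)].
  by apply: polyhedronI; apply: polyhedron_preim.
have := polyhedron_preim (row_mx 1%:M 0) 0 (polyhedron_shears (row_mx 0 1%:M) pQ).
congr polyhedron; apply/seteqP; split=> z /=.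
  move=> [t]; rewrite !addr0 !mul_mx_row !mulmx1 !mulmx0 add_row_mx.
  rewrite /= !mul_row_col !addr0 !mulmx0 !mulmx1 !add0r mulmxN mulmx1 => -[At Bt].
  by exists t => //; exists (z - t) => //; rewrite addrC subrK.
move=> [a Aa [b Bb <-]]; exists a.
rewrite !addr0 !mul_mx_row !mulmx1 !mulmx0 add_row_mx /= !mul_row_col.
by rewrite !addr0 !mulmx0 !mulmx1 !add0r mulmxN mulmx1 (addrC a) addrK.
Qed.

End Polyhedra.
Section Euler.
Variables (R : realType) (K : pzRingType).

Lemma near_all_seq (T : Type) (U : eqType) (F : set_system T) (FF : Filter F)
    (r : seq U) (P : U -> T -> Prop) :
  (forall u, u \in r -> \forall t \near F, P u t) ->
  \forall t \near F, forall u, u \in r -> P u t.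
Proof.
elim: r => [_|u r IH ur]; first by apply: nearW.
have ur1 := ur u (mem_head _ _).
have ur2 : \forall t \near F, forall u, u \in r -> P u t.
  by apply: IH => w wr; apply: ur; rewrite inE wr orbT.
near=> t => w; rewrite inE => /predU1P[->|].
  by near: t.
by move: w; near: t.
Unshelve. all: by end_near. Qed.

(* [top I (Some a)]: a is the greatest element of I;
   [top I None]: I is nonempty and unbounded above. *)
Let top (I : set R) (v : option R) : Prop :=
  if v is Some a then I a /\ (forall t, I t -> t <= a)
  else I !=set0 /\ forall a, exists2 t, I t & a < t.

Let topP (I : set R) : closed I -> I !=set0 -> exists v, top I v.
Proof.
move=> cI I0.
have [uI|/existsNP[a aI]] := pselect (forall a, exists2 t, I t & a < t).
  by exists None.
have ubI : has_ubound I.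
  exists a => t It; rewrite leNgt; apply/negP => at_.
  by apply: aI; exists t.
exists (Some (sup I)); split; first exact/cI/closure_sup.
by move=> t It; apply: ub_le_sup.
Qed.

Let top_inj (I : set R) v w : top I v -> top I w -> v = w.
Proof.
case: v => [a|]; case: w => [b|] //=.
- by move=> [Ia ub_a] [Ib ub_b]; congr Some; apply/le_anti; rewrite ub_a ?ub_b.
- by move=> [_ ub] [_ /(_ a)[t /ub]]; rewrite leNgt => /negbTE->.
- by move=> [_ /(_ b)[t + bt]] [_ ub] => /ub; rewrite leNgt bt.
Qed.

Let vanish_top (r : seq (K * set R)) (v : option R) :
  (forall u, u \in r -> closed u.2 /\ is_interval u.2) ->
  (forall t, \sum_(u <- r) u.1 * \1_(u.2) t = 0) ->
  \sum_(u <- r | `[< top u.2 v >]) u.1 = 0.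
Proof.
move=> rI r0; case: v => [a|].
  have : \forall t \near a^'+, forall u, u \in r ->
      (t \in u.2) = (a \in u.2) && ~~ `[< top u.2 (Some a) >].
    apply: near_all_seq => u /rI[cI vI].
    have [aI|aI] := pselect (u.2 a); last first.
      rewrite (memNset aI) /=.
      have ua : nbhs a (~` u.2).
        by apply: open_nbhs_nbhs; split=> //; apply: closed_openC.
      apply: filterS (cvg_within _ ua) => t; exact: memNset.
    rewrite (mem_set aI) /=.
    have [tI|tI] := pselect (top u.2 (Some a)).
      rewrite asboolT //=; near=> t; apply: memNset => It.
      have /tI.2 : u.2 t := It.
      by rewrite leNgt => /negP; apply; near: t; apply: nbhs_right_gt.
    rewrite asboolF //=.
    have [s Is as_] : exists2 s, u.2 s & a < s.
      apply: contrapT => /forall2NP H; apply: tI; split=> // t It.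
      by have [//|] := H t; move/negP; rewrite -leNgt.
    near=> t; apply: mem_set; apply: (vI a s) => //.
    by apply/andP; split; near: t; [exact: nbhs_right_ge|exact: nbhs_right_ltW].
  move=> H; have [t tr] : exists t, forall u, u \in r ->
      (t \in u.2) = (a \in u.2) && ~~ `[< top u.2 (Some a) >].
    exact: (@filter_ex _ _ (at_right_proper_filter a) _ H).
  have E : \sum_(u <- r) u.1 * \1_(u.2) a - \sum_(u <- r) u.1 * \1_(u.2) t = 0.
    by rewrite !r0 subrr.
  rewrite -[RHS]E -sumrB big_mkcond /=.
  apply: eq_big_seq => u ur; rewrite !indicE tr // -mulrBr.
  case: asboolP => [[/mem_set ->]|_] /=; first by rewrite subr0 mulr1.
  by rewrite andbT subrr mulr0.
have : \forall t \near +oo, forall u, u \in r ->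
    (t \in u.2) = `[< top u.2 None >].
  apply: near_all_seq => u /rI[cI vI].
  have [I0|/set0P/negP/negPn/eqP I0] := pselect (u.2 !=set0); last first.
    near=> t; rewrite I0 in_set0; apply/esym/asboolF => -[[]].
    by [].
  have [[a|] tI] := topP cI I0.
    rewrite asboolF; last by move=> /(top_inj tI).
    near=> t; apply: memNset => /tI.2.
    rewrite leNgt => /negP; apply; near: t.
    exact/nbhs_pinfty_gt/num_real.
  rewrite asboolT //; case: I0 => s Is; near=> t; apply: mem_set.
  have [t' It' tt'] := tI.2 t.
  apply: (vI s t') => //; rewrite (ltW tt') andbT ltW //.
  by near: t; apply/nbhs_pinfty_gt/num_real.
move=> H; have [t tr] : exists t, forall u, u \in r ->
    (t \in u.2) = `[< top u.2 None >].
  exact: (filter_ex H).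
 rewrite -[RHS](r0 t) big_mkcond /=.
apply: eq_big_seq => u ur; rewrite indicE tr //.
by case: asboolP; rewrite ?mulr1 ?mulr0.
Unshelve. all: by end_near. Qed.

Lemma vanish_interval (r : seq (K * set R)) :
  (forall u, u \in r -> closed u.2 /\ is_interval u.2) ->
  (forall t, \sum_(u <- r) u.1 * \1_(u.2) t = 0) ->
  \sum_(u <- r) u.1 * (u.2 != set0)%:R = 0.
Proof.
move=> rI r0.
pose key I := xget None [set v | top I v].
have keyP u v : u \in r ->
    `[< top u.2 v >] = (u.2 != set0) && (key u.2 == v).
  move=> /rI[cI _]; apply/asboolP/andP.
    move=> tv; split; first by apply/set0P; case: v tv => [a [Ia _]|[]//]; exists a.
    apply/eqP; rewrite /key; case: xgetP => [w _ /top_inj|/(_ v) //]; exact.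
  move=> [/set0P I0 /eqP <-]; rewrite /key; case: xgetP => [//|H].
  by have [w /H] := topP cI I0.
have sub0 (s : seq (option R)) : uniq s ->
    \sum_(u <- r | (u.2 != set0) && (key u.2 \in s)) u.1 = 0.
  elim: s => [_|v s IH /= /andP[vs us]].
    by rewrite big_pred0 // => u; rewrite in_nil andbF.
  rewrite (bigID (fun u => key u.2 == v)) /=.
  rewrite -[RHS]addr0; congr (_ + _).
    rewrite -[RHS](@vanish_top r v) // big_seq_cond [RHS]big_seq_cond.
    apply: eq_bigl => u; case ur : (u \in r) => //=.
    by rewrite keyP // inE -andbA; case: (key u.2 == v); rewrite ?orbT ?andbF.
  rewrite -[RHS](IH us); apply: eq_bigl => u; rewrite inE -andbA.
  by case: (key u.2 =P v) => [->|_] /=; rewrite ?(negbTE vs) ?andbF ?andbT.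
rewrite -[RHS](sub0 (undup [seq key u.2 | u <- r])) ?undup_uniq //.
rewrite [RHS]big_mkcond; apply: eq_big_seq => u ur.
rewrite mem_undup (map_f (fun u => key u.2)) // andbT.
by case: ifP; rewrite ?mulr1 ?mulr0.
Qed.
End Euler.
Section Convolution.
Variables (R : realType) (K : comNzRingType).

Lemma polyhedron_line n (y v : 'rV[R]_n) A : polyhedron A ->
  closed [set t : R | A (y + t *: v)] /\ is_interval [set t : R | A (y + t *: v)].
Proof.
have lineE t (h : 'cV[R]_n) :
    ((y + t *: v) *m h) 0 0 = (y *m h) 0 0 + t * (v *m h) 0 0.
  by rewrite mulmxDl -scalemxAl mxE [X in _ + X]mxE.
move=> [s ->]; split.
  have -> : [set t | [set x | forall h, h \in s -> (x *m h.1) 0 0 <= h.2] (y + t *: v)] =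
      \bigcap_(h in [set` s])
        ((fun t => (y *m h.1) 0 0 + t * (v *m h.1) 0 0) @^-1` [set x | x <= h.2]).
    apply/seteqP; split=> t /= H h hs; first by rewrite /= -lineE; exact: H.
    by rewrite lineE; exact: H.
  apply: closed_bigI => h _.
  apply: (continuous_closedP _).1; last exact: closed_le.
  by move=> t; apply: cvgD; [exact: cvg_cst|apply: cvgMl; exact: cvg_id].
move=> a b /= ha hb t /andP[at_ tb] h hs; rewrite lineE.
have := ha h hs; have := hb h hs; rewrite !lineE.
have [c0|c0] := leP 0 ((v *m h.1) 0 0) => H1 H2.
  by apply: le_trans H1; rewrite lerD2l ler_wpM2r.
by apply: le_trans H2; rewrite lerD2l ler_wnM2r // ltW.
Qed.

(* The Euler characteristic of a vanishing combination of polyhedra is zero. *)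
Lemma vanish_polyhedra n (r : seq (K * set 'rV[R]_n)) :
  (forall u, u \in r -> polyhedron u.2) ->
  (forall x, \sum_(u <- r) u.1 * \1_(u.2) x = 0) ->
  \sum_(u <- r) u.1 * (u.2 != set0)%:R = 0.
Proof.
move=> rP r0.
have vanish_shears k (B : 'M[R]_(k, n)) x :
    \sum_(u <- r) u.1 * \1_(shears B u.2) x = 0.
  elim: k B x => [|k IH] B x.
    by rewrite -[RHS](r0 x); apply: eq_bigr => u _; rewrite shears0.
  pose line (A : set 'rV[R]_n) :=
    [set t : R | shears (dsubmx (B : 'M[R]_(1 + k, n))) A
                   (x + t *: usubmx (B : 'M[R]_(1 + k, n)))].
  rewrite -[RHS](@vanish_interval R K [seq (u.1, line u.2) | u <- r]).
  - rewrite big_map; apply: eq_bigr => u _ /=; congr (_ * _); rewrite indicE (@shearsS _ k n B).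
    congr (nat_of_bool _)%:R; apply/idP/idP.
      by move=> /set_mem[t xt]; apply/set0P; exists t.
    by move=> /set0P[t xt]; apply: mem_set; exists t.
  - move=> _ /mapP[u /rP uP ->]; apply: polyhedron_line.
    exact: polyhedron_shears.
  - move=> t; rewrite big_map -[RHS](IH (dsubmx (B : 'M[R]_(1 + k, n)))
      (x + t *: usubmx (B : 'M[R]_(1 + k, n)))).
    by apply: eq_bigr => u _.
rewrite -[RHS](vanish_shears n 1%:M 0); apply: eq_bigr => u _; rewrite indicE.
congr (_ * (nat_of_bool _)%:R); apply/idP/idP.
  by move=> /set0P[x ux]; apply: mem_set; exists x; rewrite add0r mulmx1.
by move=> /set_mem[x]; rewrite add0r mulmx1 => ux; apply/set0P; exists x.
Qed.

Lemma vanish_mink_add n (r : seq (K * set 'rV[R]_n)) B :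
  (forall u, u \in r -> polyhedron u.2) -> polyhedron B ->
  (forall x, \sum_(u <- r) u.1 * \1_(u.2) x = 0) ->
  forall x, \sum_(u <- r) u.1 * \1_(mink_add u.2 B) x = 0.
Proof.
move=> rP pB r0 x; pose C := [set y | B (y *m (- 1%:M) + x)].
rewrite -[RHS](@vanish_polyhedra n [seq (u.1, u.2 `&` C) | u <- r]).
- rewrite big_map; apply: eq_bigr => u _ /=; congr (_ * (nat_of_bool _)%:R); apply/idP/idP.
    move=> /set_mem[a ua [b Bb abx]]; apply/set0P; exists a; split=> //.
    by rewrite /C /= mulmxN mulmx1 addrC -abx (addrC a) addrK.
  move=> /set0P[a [ua]]; rewrite /C /= mulmxN mulmx1 addrC => Bxa.
  by apply: mem_set; exists a => //; exists (x - a) => //; rewrite addrC subrK.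
- move=> _ /mapP[u /rP uP ->]; apply: polyhedronI => //=.
  exact: polyhedron_preim.
- move=> y; rewrite big_map /=.
  under eq_bigr do rewrite indicI /= mulrA.
  by rewrite -mulr_suml r0 mul0r.
Qed.
End Convolution.

Local Open Scope complex_scope.

Section PolyAlgebra.
Variables (R : realType) (d : nat).
Local Notation W := 'rV[R]_d.
Implicit Types (r s t : seq (R[i] * set W)) (A B : set W).

(* A finite formal combination of sets, and the function it denotes. *)
Definition comb r : W -> R[i] := fun x => \sum_(u <- r) u.1 * \1_(u.2) x.

Definition poly_comb r := forall u, u \in r -> polyhedron u.2.

Definition poly_span (f : W -> R[i]) : Prop :=
  exists2 r, poly_comb r & f = comb r.

Definition mem_poly_span : {pred W -> R[i]} := [pred f | `[< poly_span f >]].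

Lemma comb_cat r s x : comb (r ++ s) x = comb r x + comb s x.
Proof. exact: big_cat. Qed.

Lemma poly_comb_cat r s : poly_comb r -> poly_comb s -> poly_comb (r ++ s).
Proof. by move=> rP sP u; rewrite mem_cat => /orP[/rP|/sP]. Qed.

Definition comb_scale (a : R[i]) r := [seq (a * u.1, u.2) | u <- r].

Lemma comb_scaleE a r x : comb (comb_scale a r) x = a * comb r x.
Proof.
by rewrite /comb big_map mulr_sumr; apply: eq_bigr => u _; rewrite mulrA.
Qed.

Lemma poly_comb_scale a r : poly_comb r -> poly_comb (comb_scale a r).
Proof. by move=> rP _ /mapP[u /rP uP ->]. Qed.

Lemma poly_span_submod : GRing.submod_closed mem_poly_span.
Proof.
split=> [|a f g /asboolP[r rP ->] /asboolP[s sP ->]]; apply/asboolP.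
  by exists [::] => //; apply/funext => x; rewrite /comb big_nil.
exists (comb_scale a r ++ s); first exact/poly_comb_cat/sP/poly_comb_scale.
by apply/funext => x; rewrite comb_cat comb_scaleE.
Qed.

HB.instance Definition _ :=
  GRing.isSubmodClosed.Build R[i] (W -> R[i]) mem_poly_span poly_span_submod.

(* The space M(P(W)); its ring structure, set up below, is given by the
   Minkowski product and not by pointwise multiplication of functions. *)
Record polyM := PolyM { polyM_fun :> W -> R[i]; _ : polyM_fun \in mem_poly_span }.
HB.instance Definition _ := [isSub for polyM_fun].
HB.instance Definition _ := [Choice of polyM by <:].
HB.instance Definition _ := [SubChoice_isSubLmodule of polyM by <:].
Implicit Types f g h : polyM.

Lemma polyM_ext f g : (forall x, f x = g x) -> f = g.
Proof. by move=> fg; apply/val_inj/funext. Qed.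

Lemma polyM_comb_ex f : exists2 r, poly_comb r & (f : W -> R[i]) = comb r.
Proof. by case: f => f /= /asboolP. Qed.

Lemma comb_polyM r : poly_comb r -> comb r \in mem_poly_span.
Proof. by move=> rP; apply/asboolP; exists r. Qed.

(* A chosen representation; by [polyM_mulE] the product does not depend on it. *)
Definition rep f := s2val (cid2 (polyM_comb_ex f)).

Lemma repP f : poly_comb (rep f).
Proof. exact: (s2valP (cid2 (polyM_comb_ex f))). Qed.

Lemma repE f x : f x = comb (rep f) x.
Proof. by rewrite [in LHS](s2valP' (cid2 (polyM_comb_ex f))). Qed.

(* Empty sets may occur in representations; their Minkowski sums are empty and
   contribute the zero function. *)
Definition comb_mul r s :=
  [seq (u.1 * v.1, mink_add u.2 v.2) | u <- r, v <- s].

Lemma poly_comb_mul r s : poly_comb r -> poly_comb s -> poly_comb (comb_mul r s).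
Proof.
move=> rP sP _ /allpairsP[[u v] /= [/rP uP /sP vP ->]].
exact: polyhedron_mink_add.
Qed.

Lemma comb_mulE r s x :
  comb (comb_mul r s) x =
  \sum_(u <- r) \sum_(v <- s) u.1 * v.1 * \1_(mink_add u.2 v.2) x.
Proof. by rewrite /comb big_allpairs_dep. Qed.

Definition polyM_mul f g : polyM :=
  PolyM (comb_polyM (poly_comb_mul (@repP f) (@repP g))).

Lemma mink_addC A B : mink_add A B = mink_add B A.
Proof.
by apply/seteqP; split=> _ [a aA [b bB <-]]; exists b => //; exists a;
  rewrite // addrC.
Qed.

Lemma mink_addA A B C :
  mink_add A (mink_add B C) = mink_add (mink_add A B) C.
Proof.
apply/seteqP; split=> x.
  move=> [a aA [_ [b bB [c cC <-]] <-]]; rewrite addrA.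
  by exists (a + b); [exists a => //; exists b|exists c].
move=> [_ [a aA [b bB <-]] [c cC <-]]; rewrite -addrA.
by exists a => //; exists (b + c) => //; exists b => //; exists c.
Qed.

Lemma mink_add0 A : mink_add [set 0] A = A.
Proof.
apply/seteqP; split=> x; first by move=> [_ -> [a aA <-]]; rewrite add0r.
by exists 0 => //; exists x => //; rewrite add0r.
Qed.

Lemma comb_mulC r s : comb (comb_mul r s) =1 comb (comb_mul s r).
Proof.
move=> x; rewrite !comb_mulE exchange_big; apply: eq_bigr => v _.
by apply: eq_bigr => u _; rewrite mulrC [v.1 * _]mulrC mulrC mink_addC.
Qed.

Lemma comb_mul_eql r r' s : poly_comb r -> poly_comb r' -> poly_comb s ->
  comb r =1 comb r' -> comb (comb_mul r s) =1 comb (comb_mul r' s).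
Proof.
move=> rP rP' sP rr' x; rewrite !comb_mulE exchange_big [RHS]exchange_big /=.
apply: eq_big_seq => v /sP vP; apply/eqP; rewrite -subr_eq0; apply/eqP.
have rrP : poly_comb (r ++ comb_scale (-1) r').
  exact/poly_comb_cat/poly_comb_scale.
have vanish y : comb (r ++ comb_scale (-1) r') y = 0.
  by rewrite comb_cat comb_scaleE rr' mulN1r subrr.
rewrite -[RHS](mulr0 v.1) -[in RHS](vanish_mink_add rrP vP vanish x).
rewrite big_cat big_map mulrDr /= !mulr_sumr -sumrN; congr (_ + _).
  by apply: eq_bigr => u _; rewrite mulrCA mulrA.
by apply: eq_bigr => u _; rewrite mulN1r mulNr mulrN mulrCA mulrA.
Qed.

Lemma polyM_mulE f g r s : poly_comb r -> poly_comb s ->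
  (forall x, f x = comb r x) -> (forall x, g x = comb s x) ->
  forall x, polyM_mul f g x = comb (comb_mul r s) x.
Proof.
move=> rP sP fr gs x /=.
rewrite (comb_mul_eql (@repP f) rP (@repP g)); last by move=> y; rewrite -repE fr.
rewrite comb_mulC (comb_mul_eql (@repP g) sP rP) 1?comb_mulC //.
by move=> y; rewrite -repE gs.
Qed.

Lemma polyM_mulC : commutative polyM_mul.
Proof. by move=> f g; apply: polyM_ext => x; rewrite /= comb_mulC. Qed.

Lemma polyM_mulA : associative polyM_mul.
Proof.
move=> f g h; apply: polyM_ext => x.
rewrite (polyM_mulE (@repP f) (poly_comb_mul (@repP g) (@repP h)) (repE f)) //.
rewrite (polyM_mulE (poly_comb_mul (@repP f) (@repP g)) (@repP h) _ (repE h)) //.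
rewrite !comb_mulE [RHS]big_allpairs_dep; apply: eq_bigr => u _.
rewrite [LHS]big_allpairs_dep; apply: eq_bigr => v _.
by apply: eq_bigr => w _; rewrite /= mulrA mink_addA.
Qed.

(* The class [A] of a polyhedron A. *)
Definition indM A (pA : polyhedron A) : polyM.
Proof.
apply: (@PolyM (\1_A)); apply/asboolP; exists [:: (1, A)].
  by move=> u; rewrite inE => /eqP->.
by apply/funext => x; rewrite /comb big_seq1 mul1r.
Defined.

Lemma poly_comb1 A : polyhedron A -> poly_comb [:: (1, A)].
Proof. by move=> pA u; rewrite inE => /eqP->. Qed.

Lemma comb1E A x : comb [:: (1, A)] x = \1_A x.
Proof. by rewrite /comb big_seq1 mul1r. Qed.

Lemma polyM_mul1 : left_id (indM (@polyhedron_origin R d)) polyM_mul.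
Proof.
move=> f; apply: polyM_ext => x.
rewrite (polyM_mulE (poly_comb1 (@polyhedron_origin R d)) (@repP f) _ (repE f)).
  by rewrite comb_mulE big_seq1 repE; apply: eq_bigr => u _; rewrite mul1r mink_add0.
by move=> y; rewrite comb1E.
Qed.

Lemma polyM_mulDl : left_distributive polyM_mul +%R.
Proof.
move=> f g h; apply: polyM_ext => x.
rewrite (polyM_mulE (poly_comb_cat (@repP f) (@repP g)) (@repP h) _ (repE h)).
  by rewrite !comb_mulE big_cat /=; congr (_ + _); rewrite comb_mulE.
by move=> y; rewrite comb_cat -!repE.
Qed.

Lemma polyM_mulZl a f g : a *: polyM_mul f g = polyM_mul (a *: f) g.
Proof.
apply: polyM_ext => x.
rewrite (polyM_mulE (@poly_comb_scale a _ (@repP f)) (@repP g) _ (repE g)).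
  rewrite comb_mulE big_map /= [LHS](_ : _ = a * comb (comb_mul (rep f) (rep g)) x) //.
  rewrite comb_mulE mulr_sumr; apply: eq_bigr => u _.
  by rewrite mulr_sumr; apply: eq_bigr => v _; rewrite !mulrA.
by move=> y; rewrite comb_scaleE -repE.
Qed.

Lemma polyM_1neq0 : indM (@polyhedron_origin R d) != 0.
Proof.
apply/eqP => E; have /eqP : (1 : R[i]) = 0; last by rewrite oner_eq0.
transitivity (indM (@polyhedron_origin R d) 0); last by rewrite E.
by rewrite /= indicE mem_set.
Qed.

HB.instance Definition _ := GRing.Zmodule_isComNzRing.Build polyM
  polyM_mulA polyM_mulC polyM_mul1 polyM_mulDl polyM_1neq0.
HB.instance Definition _ :=
  GRing.Lmodule_isLalgebra.Build R[i] polyM polyM_mulZl.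
HB.instance Definition _ := GRing.Lalgebra_isComAlgebra.Build R[i] polyM.

Lemma indM_one : indM (@polyhedron_origin R d) = 1.
Proof. by []. Qed.

Lemma indM_mul A B (pA : polyhedron A) (pB : polyhedron B) :
  indM pA * indM pB = indM (polyhedron_mink_add pA pB).
Proof.
apply: polyM_ext => x.
rewrite [LHS](polyM_mulE (poly_comb1 pA) (poly_comb1 pB)).
- by rewrite comb_mulE !big_seq1 !mul1r.
- by move=> y; rewrite comb1E.
- by move=> y; rewrite comb1E.
Qed.

End PolyAlgebra.

Section GeneratedSubalgebra.
Variables (K : comNzRingType) (A : comAlgType K) (a : A).

(* The intersection of all unital subalgebras containing [a]. *)
Definition mem_gen_subalg : {pred A} := [pred f |
  `[< forall B : {pred A}, GRing.subalg_closed B -> a \in B -> f \in B >]].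

Lemma gen_subalg_closed : GRing.subalg_closed mem_gen_subalg.
Proof.
split=> [|c f g /asboolP fP /asboolP gP|f g /asboolP fP /asboolP gP];
  apply/asboolP => B cB aB; have [B1 BZ BM] := cB => //.
- by apply: BZ; [exact: fP|exact: gP].
- by apply: BM; [exact: fP|exact: gP].
Qed.

HB.instance Definition _ :=
  GRing.isSubalgClosed.Build K A mem_gen_subalg gen_subalg_closed.

Record gen_subalg :=
  GenSubalg { gen_subalg_val :> A; _ : gen_subalg_val \in mem_gen_subalg }.
HB.instance Definition _ := [isSub for gen_subalg_val].
HB.instance Definition _ := [Choice of gen_subalg by <:].
HB.instance Definition _ := [SubChoice_isSubAlgebra of gen_subalg by <:].
HB.instance Definition _ := [SubNzRing_isSubComNzRing of gen_subalg by <:].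

Lemma mem_gen_subalg_id : a \in mem_gen_subalg.
Proof. by apply/asboolP. Qed.

Definition gen_subalg_gen : gen_subalg := GenSubalg mem_gen_subalg_id.

Lemma horner_gen_subalg (p : {poly K}) :
  gen_subalg_val (horner_alg gen_subalg_gen p) = horner_alg a p.
Proof.
elim/poly_ind: p => [|p c IH]; first by rewrite !raddf0.
rewrite !rmorphD !rmorphM /= !horner_algX !horner_algC.
by rewrite -[LHS]/(gen_subalg_val (horner_alg gen_subalg_gen p) * a + c%:A) IH.
Qed.

Lemma horner_gen_subalg_surj (f : gen_subalg) :
  exists p : {poly K}, horner_alg gen_subalg_gen p = f.
Proof.
case: f => f /= fgen; have /asboolP := fgen.
pose B : {pred A} := [pred g | `[< exists p : {poly K}, horner_alg a p = g >]].
have cB : GRing.subalg_closed B.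
  split=> [|c g h /asboolP[p <-] /asboolP[q <-]|g h /asboolP[p <-] /asboolP[q <-]];
    apply/asboolP.
  - by exists 1; rewrite rmorph1.
  - by exists (c *: p + q); rewrite rmorphD -mul_polyC rmorphM /= horner_algC mulr_algl.
  - by exists (p * q); rewrite rmorphM.
have aB : a \in B by apply/asboolP; exists 'X; rewrite horner_algX.
move=> /(_ B cB aB)/asboolP[p pf]; exists p; apply: val_inj.
exact: etrans (horner_gen_subalg p) pf.
Qed.

Lemma gen_subalg_morph_surj (phi : {lrmorphism {poly K} -> gen_subalg}) :
  phi 'X = gen_subalg_gen -> forall f, exists p, phi p = f.
Proof.
move=> phiX f; have [p <-] := horner_gen_subalg_surj f.
by exists p; rewrite (poly_alg_initial phi) phiX.
Qed.
End GeneratedSubalgebra.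

Section Kernel.
Variables (K : comNzRingType).

Definition ker_ideal (A : pzRingType) (phi : {poly K} -> A) : set {poly K} :=
  [set p | phi p = 0].

Definition principal_ideal (g : {poly K}) : set {poly K} :=
  [set q * g | q in [set: {poly K}]].

End Kernel.

(* Main.v *)
(** Since [S]^k is the indicator function of the k-fold Minkowski sum kS, the
    kernel consists of the linear relations between the functions [kS]. When S
    is not a cone, one of its defining linear forms has a finite nonzero
    supremum a over S, hence supremum ka over kS. Intersecting a relation
    sum_k c_k [kS] = 0 with the half-space where the form is at least t and
    taking Euler characteristics gives sum_k c_k (t < ka) = 0 whenever t is not
    a multiple of a; comparing t = (n - 1/2) a and t = (n + 1/2) a yields
    c_n = 0. *)

Require Import Defs.
From mathcomp Require Import all_boot all_order all_algebra.
From mathcomp Require Import all_classical all_reals all_analysis.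
From mathcomp Require Import complex lra.

Set Implicit Arguments.
Unset Strict Implicit.
Unset Printing Implicit Defensive.

Import Order.TTheory GRing.Theory Num.Theory numFieldNormedType.Exports.
Local Open Scope classical_set_scope.
Local Open Scope ring_scope.
Local Open Scope complex_scope.

(** * Minkowski powers, cones and suprema of linear forms *)

Section MinkowskiPowers.
Variables (R : realType) (d : nat).
Implicit Types S : set 'rV[R]_d.

(** The power 0 is {0} even for empty S, in agreement with [S]^0 = 1. *)
Definition mink_pow S n : set 'rV[R]_d := iter n (mink_add S) [set 0].

Lemma polyhedron_mink_pow S n : polyhedron S -> polyhedron (mink_pow S n).
Proof.
move=> pS; elim: n => [|n IH]; first exact: polyhedron_origin.
exact: polyhedron_mink_add.
Qed.

(** Lets sets be exchanged under [indM] although it carries a proof of polyhedrality. *)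
Lemma indM_eq A B (pA : polyhedron A) (pB : @polyhedron R d B) :
  A = B -> indM pA = indM pB.
Proof. by move=> AB; apply: polyM_ext => x /=; rewrite AB. Qed.

Lemma indM_exp S (pS : polyhedron S) n :
  indM pS ^+ n = indM (polyhedron_mink_pow n pS).
Proof.
elim: n => [|n IH]; first by rewrite expr0 -indM_one; apply: indM_eq.
by rewrite exprS IH indM_mul; apply: indM_eq.
Qed.

(** With [mink_pow_le], this makes the supremum of a linear form over kS equal to k times its
    supremum over S. *)
Lemma mink_pow_muln S s n : S s -> mink_pow S n (s *+ n).
Proof.
by move=> Ss; elim: n => //= n IH; rewrite mulrS; exists s => //; exists (s *+ n).
Qed.

Lemma mink_pow_le S (h : 'cV[R]_d) (a : R) n : (forall s, S s -> (s *m h) 0 0 <= a) ->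
  forall y, mink_pow S n y -> (y *m h) 0 0 <= n%:R * a.
Proof.
move=> Sa; elim: n => [y /= ->|n IH _ [s /Sa sa [y /IH ya <-]]].
  by rewrite mul0mx mxE mul0r.
by rewrite mulmxDl mxE -natr1 mulrDl mul1r addrC lerD.
Qed.

(** By convexity x + y is twice a point of S, hence in 2S = S; conversely 2y = y + y. *)
Lemma mink_add_idem S : polyhedron S -> S = dilate 2 S -> mink_add S S = S.
Proof.
move=> [s Ss] S2; apply/seteqP; split=> [_ [x Sx [y Sy <-]]|x].
  rewrite S2; exists (2^-1 *: (x + y)); last by rewrite scalerA divff ?scale1r.
  move: Sx Sy; rewrite Ss => /= xs ys h hs.
  rewrite -scalemxAl mulmxDl mxE [X in _ * X]mxE.
  by have := xs h hs; have := ys h hs; lra.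
rewrite {1}S2 => -[y Sy <-]; exists y => //; exists y => //.
by rewrite scaler_nat.
Qed.

(** Otherwise every defining form has supremum 0 over S, so all right-hand sides can be replaced by
    0. Then S is a cone and S = 2S. *)
Lemma polyhedron_sup_neq0 S : polyhedron S -> S !=set0 -> S <> dilate 2 S ->
  exists (h : 'cV[R]_d) (a : R), [/\ a != 0, forall s, S s -> (s *m h) 0 0 <= a
    & forall b : R, b < a -> exists2 s, S s & b < (s *m h) 0 0].
Proof.
move=> [s Ss] S0 S2; apply: contrapT => noh; apply: S2.
pose I (h : 'cV[R]_d * R) := [set (x *m h.1) 0 0 | x in S].
have I0 g : I g !=set0 by case: S0 => x Sx; exists ((x *m g.1) 0 0), x.
have Ile g : g \in s -> ubound (I g) g.2.
  by move=> hs _ [x + <-]; rewrite Ss; apply.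
have supI g : g \in s -> sup (I g) = 0.
  move=> gs; apply/eqP/negPn/negP => a0; apply: noh.
  have hsI : has_sup (I g) by split => //; exists g.2; exact: Ile.
  exists g.1, (sup (I g)); split=> // [x Sx|b].
    by apply: ub_le_sup; [exact: hsI.2|exists x].
  by move=> /(sup_gt (I0 g)) [_ [x Sx <-] bx]; exists x.
have SE : S = [set x | forall h, h \in s -> (x *m h.1) 0 0 <= 0].
  apply/seteqP; split=> x /= Sx.
    move=> h hs; rewrite -(supI _ hs); apply: ub_le_sup; last by exists x.
    by exists h.2; exact: Ile.
  rewrite Ss => h hs; apply: le_trans (Sx h hs) _.
  by rewrite -(supI _ hs); apply: ge_sup => //; exact: Ile.
have scale c x : 0 <= c -> S x -> S (c *: x).
  move=> c0; rewrite SE => /= xs h hs.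
  by rewrite -scalemxAl mxE mulr_ge0_le0 // xs.
apply/seteqP; split=> [x Sx|_ [x Sx <-]]; last exact: scale.
exists (2^-1 *: x); first by apply: scale; rewrite ?invr_ge0.
by rewrite scalerA divff ?scale1r.
Qed.

End MinkowskiPowers.

(** * Linear relations between the indicators of Minkowski powers *)

Section Relations.
Variables (R : realType) (d : nat).
Implicit Types (S : set 'rV[R]_d) (p : {poly R[i]}).

Lemma horner_alg_indM S (pS : polyhedron S) p x :
  horner_alg (indM pS) p x = \sum_(k < size p) p`_k * \1_(mink_pow S k) x.
Proof.
rewrite -{1}[p]coefK poly_def linear_sum /=.
rewrite (big_morph (fun f : polyM R d => f x) (id1 := 0) (op1 := +%R)) //.
apply: eq_bigr => k _.
have -> : horner_alg (indM pS) (p`_k *: 'X^k) =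
    p`_k *: indM (polyhedron_mink_pow k pS).
  by rewrite -mul_polyC rmorphM /= horner_algC mulr_algl rmorphXn /=
    horner_algX indM_exp.
by [].
Qed.

Lemma horner_alg_indM_eq0 S (pS : polyhedron S) p : S !=set0 ->
  S <> dilate 2 S -> horner_alg (indM pS) p = 0 -> p = 0.
Proof.
move=> S0 S2 p0.
have [h [a [a0 Sa Sb]]] := polyhedron_sup_neq0 pS S0 S2.
(* kS meets the half-space H exactly when t < ka. Excluding t = ka avoids asking whether the
   supremum is attained. *)
have chi (t : R) : (forall k : nat, t != k%:R * a) ->
    \sum_(k < size p) p`_k * (t < k%:R * a)%R%:R = 0.
  move=> ta; pose H := [set y : 'rV[R]_d | t <= (y *m h) 0 0].
  have pH : polyhedron H.
    exists [:: (- h, - t)]; apply/seteqP; split=> y /=.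
      by move=> Hy _ /[!inE] /eqP -> /=; rewrite mulmxN mxE lerN2.
    by move=> /(_ _ (mem_head _ _)) /=; rewrite mulmxN mxE lerN2.
  rewrite -[RHS](@vanish_polyhedra R R[i] d
    [seq (p`_k, mink_pow S k `&` H) | k : 'I_(size p) <- index_enum _]).
  - rewrite big_map /=; apply: eq_bigr => k _.
    rewrite (_ : (t < _)%R = (mink_pow S k `&` H != set0)) //; apply/idP/idP.
      move=> tk; apply/set0P; have [k0|k0] := posnP k.
        exists 0; rewrite /H k0; split => //=.
        by rewrite mul0mx mxE ltW //; move: tk; rewrite k0 mul0r.
      have k0' : (0 : R) < k%:R by rewrite ltr0n.
      (* A point s of S with form value above t / k yields the point ks of kS in H. *)
      have [|s Ss ts] := Sb (t / k%:R); first by rewrite ltr_pdivrMr // mulrC.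
      exists (s *+ k); split; first exact: mink_pow_muln.
      rewrite /H /= -scaler_nat -scalemxAl mxE mulrC -ler_pdivrMr //.
      exact: ltW.
    move=> /set0P[y [Sy Hy]]; rewrite lt_neqAle ta /=.
    exact: le_trans Hy (mink_pow_le Sa Sy).
  - move=> _ /mapP[k _ ->]; apply: polyhedronI => //.
    exact: polyhedron_mink_pow.
  - move=> x; rewrite big_map /=; under eq_bigr do rewrite indicI /= mulrA.
    by rewrite -mulr_suml -(horner_alg_indM pS) p0 mul0r.
(* After doubling, an odd number would equal an even one. *)
have half (n k : nat) : n%:R + 2^-1 != k%:R :> R.
  rewrite -(inj_eq (mulIf (_ : 2 != 0))) // mulrDl mulVf // -!natrM natr1 eqr_nat.
  by apply/eqP => /(congr1 odd); rewrite /= !oddM !andbF.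
apply/polyP => n; rewrite coef0.
have [|np] := leqP (size p) n; first exact: nth_default.
have chi1 := chi ((n%:R + 2^-1) * a).
have chi2 := chi ((n%:R - 2^-1) * a).
have {}chi1 : \sum_(k < size p) p`_k * ((n%:R + 2^-1) * a < k%:R * a)%R%:R = 0.
  by apply: chi1 => k; rewrite (inj_eq (mulIf a0)).
have {}chi2 : \sum_(k < size p) p`_k * ((n%:R - 2^-1) * a < k%:R * a)%R%:R = 0.
  apply: chi2 => k; rewrite (inj_eq (mulIf a0)); apply/eqP => E.
  by case/eqP: (half k n); lra.
have cmp1 (k : nat) : (n%:R + 2^-1 < k%:R :> R) = (n < k)%N.
  apply/idP/idP => [|nk].
    by apply: contraTT; rewrite -leqNgt -leNgt => kn;
      move: kn; rewrite -(ler_nat R); lra.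
  by move: nk; rewrite -(ler_nat R) -natr1; lra.
have cmp2 (k : nat) : (n%:R - 2^-1 < k%:R :> R) = (n <= k)%N.
  apply/idP/idP => [|nk].
    apply: contraTT; rewrite -ltnNge -leNgt -(ler_nat R) -natr1; lra.
  by move: nk; rewrite -(ler_nat R); lra.
have cmp1' (k : nat) : (k%:R < n%:R + 2^-1 :> R) = (k <= n)%N.
  by rewrite lt_neqAle eq_sym half leNgt cmp1 -leqNgt.
have cmp2' (k : nat) : (k%:R < n%:R - 2^-1 :> R) = (k < n)%N.
  rewrite lt_neqAle leNgt cmp2 -ltnNge andbC.
  case: (ltnP k n) => //= _; apply/eqP => E.
  by case/eqP: (half k n); lra.
(* The two indicator families differ only at k = n, by c, so subtracting the relations isolates c
   times the n-th coefficient. *)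
have pick (b : bool -> nat -> bool) (c : R[i]) :
    (forall k, (b true k)%:R - (b false k)%:R = c * (k == n)%:R) ->
    \sum_(k < size p) p`_k * (b true k)%:R = 0 ->
    \sum_(k < size p) p`_k * (b false k)%:R = 0 -> c * p`_n = 0.
  move=> bc bt bf; transitivity (\sum_(k < size p) p`_k * (b true k)%:R -
      \sum_(k < size p) p`_k * (b false k)%:R); last by rewrite bt bf subrr.
  rewrite -sumrB (bigD1 (Ordinal np)) //= big1 ?addr0 => [|k kn].
    by rewrite -mulrBr bc eqxx mulr1 mulrC.
  by rewrite -mulrBr bc (_ : (_ == _) = false) ?mulr0 //; apply: negbTE.
(* Cancelling a < 0 reverses the comparisons: the families become k < n and k <= n, whence c = -1.
   For a > 0 they are n <= k and n < k, with c = 1. *)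
have [a_lt|a_gt|aE] := ltgtP a 0; last by rewrite aE eqxx in a0.
  have : - 1 * p`_n = 0; last by move=> /eqP; rewrite mulN1r oppr_eq0 => /eqP.
  apply: (pick (fun b k => if b then (k < n)%N else (k <= n)%N)) => /= [k||].
  - by case: ltngtP; rewrite ?subrr ?mulr0 ?mulr1 ?sub0r.
  - by apply: etrans chi2; apply: eq_bigr => k _; rewrite ltr_nM2r // cmp2'.
  - by apply: etrans chi1; apply: eq_bigr => k _; rewrite ltr_nM2r // cmp1'.
rewrite -[LHS]mul1r.
apply: (pick (fun b k => if b then (n <= k)%N else (n < k)%N)) => /= [k||].
- by case: ltngtP; rewrite ?subrr ?mulr0 ?mulr1 ?subr0.
- by apply: etrans chi2; apply: eq_bigr => k _; rewrite ltr_pM2r // cmp2.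
- by apply: etrans chi1; apply: eq_bigr => k _; rewrite ltr_pM2r // cmp1.
Qed.

End Relations.

(** * Principal kernels and the four cases *)

Lemma ker_ideal_principal (F : fieldType) (A : pzRingType)
    (f : {rmorphism {poly F} -> A}) (m : {poly F}) : m != 0 -> f m = 0 ->
  (forall p : {poly F}, (size p < size m)%N -> f p = 0 -> p = 0) ->
  ker_ideal f = principal_ideal m.
Proof.
move=> m0 fm small; apply/seteqP; split=> p; rewrite /ker_ideal /=.
  move=> fp; exists (p %/ m) => //; rewrite [RHS](divp_eq p m).
  (* The remainder of p modulo m is in the kernel and smaller than m, so it vanishes. *)
  rewrite [X in _ + X]small ?addr0 ?ltn_modp //.
  by move: fp; rewrite {1}(divp_eq p m) rmorphD rmorphM /= fm mulr0 add0r.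
by move=> [q _ <-]; rewrite rmorphM /= fm mulr0.
Qed.

(** A nonzero x in S would bring along all 2^n x, which are unbounded. *)
Lemma bounded_dilate2 (R : realType) d (S : set 'rV[R]_d) :
  bounded_set S -> S !=set0 -> S = dilate 2 S -> S = [set 0].
Proof.
move=> [M [_ bM]] S0 S2.
have S_sub0 x : S x -> x = 0.
  move=> Sx; apply/eqP/negPn/negP; rewrite -normr_gt0 => x0.
  have Spow n : S (2 ^+ n *: x).
    elim: n => [|n IH]; first by rewrite scale1r.
    by rewrite S2; exists (2 ^+ n *: x) => //; rewrite scalerA exprS.
  (* Boundedness provides a bound only for radii strictly above M, hence M + 1. *)
  have le n : 2 ^+ n * `|x| <= M + 1.
    have := bM (M + 1); rewrite ltrDl ltr01 => /(_ isT _ (Spow n)).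
    by rewrite /= mx_normZ ger0_norm ?exprn_ge0.
  pose n := Num.Def.truncn ((M + 1) / `|x|).
  have := le n.+1; rewrite -ler_pdivlMr // leNgt => /negP; apply.
  apply: lt_le_trans (truncnS_gt _) _.
  by rewrite -natrX ler_nat ltnW // ltn_expl.
case: S0 => x Sx; apply/seteqP; split=> [y /S_sub0 -> //|_ ->].
by rewrite -(S_sub0 _ Sx).
Qed.

(** The fourth and sixth conjuncts are the two particular claims: S = W falls under (c), bounded S
    under (d). *)
Theorem mainTheorem1 (R : realType) (d : nat) (hd : (0 < d)%N)
    (S : set 'rV[R]_d) (polyS : polyhedron S)
    (phi : {lrmorphism {poly R[i]} -> gen_subalg (indM polyS)})
    (phiX : phi 'X = gen_subalg_gen (indM polyS)) :
  (S = set0 -> ker_ideal phi = principal_ideal 'X) /\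
  (S = [set 0] -> ker_ideal phi = principal_ideal ('X - 1)) /\
  (S <> set0 -> S <> [set 0] -> S = dilate 2 S ->
     ker_ideal phi = principal_ideal ('X * ('X - 1))) /\
  (S = setT -> [/\ S <> set0, S <> [set 0] & S = dilate 2 S]) /\
  (S <> set0 -> S <> [set 0] -> S <> dilate 2 S ->
     ker_ideal phi = principal_ideal 0) /\
  (bounded_set S -> S <> set0 -> S <> [set 0] -> S <> dilate 2 S).
Proof.
(* [phi] is evaluation at the generator, and M(S) embeds in M(P(W)), so the kernel is that of
   evaluation at [S]. *)
have -> : ker_ideal phi = ker_ideal (horner_alg (indM polyS)).
  apply/seteqP; split=> p; rewrite /ker_ideal /= (poly_alg_initial phi) phiX.
    by move=> /(congr1 (@gen_subalg_val _ _ _)); rewrite horner_gen_subalg.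
  by rewrite -horner_gen_subalg => E; apply: val_inj.
(* A constant c goes to c[{0}], and the unit [{0}] is nonzero. *)
have kerC (p : {poly R[i]}) : (size p <= 1)%N -> horner_alg (indM polyS) p = 0 -> p = 0.
  move=> /size1_polyC ->; rewrite horner_algC => /eqP.
  by rewrite scaler_eq0 oner_eq0 orbF => /eqP ->.
have X1 : 'X - 1 = 'X - 1%:P :> {poly R[i]} by [].
split=> [S0|]; last split=> [S1|]; last split=> [S0 S1 S2|];
  last split=> [ST|]; last split=> [/eqP/set0P S0 S1 S2|bS /eqP/set0P S0 S1 S2].
- apply: ker_ideal_principal; first by rewrite polyX_eq0.
    by rewrite [LHS]horner_algX; apply: polyM_ext => x /=; rewrite S0 indic0.
  by rewrite size_polyX.
- apply: ker_ideal_principal; first by rewrite X1 polyXsubC_eq0.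
    rewrite -[LHS]/(horner_alg (indM polyS) ('X - 1)).
    rewrite rmorphB rmorph1 /= horner_algX -indM_one.
    by rewrite (indM_eq polyS (@polyhedron_origin R d) S1) subrr.
  by rewrite X1 size_XsubC.
- have sz : size ('X * ('X - 1) : {poly R[i]}) = 3%N.
    by rewrite X1 mulrC size_mulX ?polyXsubC_eq0 // size_XsubC.
  (* At such a point x, [S] is 1 and [{0}] is 0; evaluating a relation of degree at most 1 there
     leaves the linear coefficient. *)
  have [x Sx x0] : exists2 x, S x & x != 0.
    apply: contrapT => /forall2NP H; have Sz y : S y -> y = 0.
      by case: (H y) => // /negP; rewrite negbK => /eqP.
    have /set0P[z Sz'] : S != set0 by exact/eqP.
    by apply: S1; apply/seteqP; split=> [y /Sz|_ ->] //; rewrite -(Sz z Sz').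
  apply: ker_ideal_principal; first by rewrite -size_poly_gt0 sz.
    (* S + S = S makes [S] idempotent. *)
    rewrite -[LHS]/(horner_alg (indM polyS) ('X * ('X - 1))).
    rewrite rmorphM rmorphB rmorph1 /= horner_algX mulrBr mulr1 indM_mul.
    by apply/eqP; rewrite subr_eq0; apply/eqP/indM_eq/mink_add_idem.
  rewrite sz => p; rewrite ltnS => sp ap.
  have p1 : p`_1 = 0.
    have pE : p = p`_1 *: 'X + (p`_0)%:P.
      apply/polyP => -[|[|k]]; rewrite coefD coefZ coefX coefC /=.
      - by rewrite mulr0 add0r.
      - by rewrite mulr1 addr0.
      - by rewrite mulr0 addr0 nth_default // (leq_trans sp).
    have aE : horner_alg (indM polyS) p = p`_1 *: indM polyS + p`_0 *: 1.
      by rewrite {1}pE -mul_polyC rmorphD rmorphM /= !horner_algC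
        horner_algX mulr_algl.
    have /(congr1 (fun f : polyM R d => f x)) := etrans (esym aE) ap.
    rewrite -[LHS]/(p`_1 * \1_S x + p`_0 * \1_[set 0] x) !indicE mem_set //.
    by rewrite memNset ?mulr0 ?addr0 ?mulr1 //= => /eqP; rewrite (negbTE x0).
  apply: kerC => //; apply/leq_sizeP => -[|[|k]] // _.
  by rewrite nth_default // (leq_trans sp).
- rewrite ST; split=> [T0|T1|].
  + by have : set0 (0 : 'rV[R]_d) by rewrite -T0.
  (* The all-ones vector is nonzero because d is positive. *)
  + have : [set 0] (const_mx 1 : 'rV[R]_d) by rewrite -T1.
    move=> /rowP /(_ (Ordinal hd)); rewrite !mxE => /eqP.
    by rewrite oner_eq0.
  + apply/seteqP; split=> // x _; exists (2^-1 *: x) => //.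
    by rewrite scalerA divff ?scale1r.
- apply/seteqP; split=> p; rewrite /ker_ideal /=.
    by move=> /(horner_alg_indM_eq0 S0 S2) ->; exists 0; rewrite ?mulr0.
  by move=> [q _ <-]; rewrite mulr0 rmorph0.
- exact/S1/bounded_dilate2.
Qed.
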